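(* Let $F,G\in\mathbb{R}[x,y,z]$, let $\mathcal{C}=\{F=0\}\cap\{G=0\}$ be the space algebraic curve they define, and let $P=(a,b,c)$ be a regular point of $\mathcal{C}$, i.e. $F(P)=G(P)=0$ and $(\nabla F\times\nabla G)(P)\neq0$. Then the curvature and torsion of $\mathcal{C}$ at $P$ obtained by the cubic-contact algorithm described in the context are $$k=\frac{|\mathbf{r}'\times\mathbf{r}''|}{|\mathbf{r}'|^3}=\frac{\bigl|\bigl((\nabla F\times\nabla G)\cdot\nabla(\nabla F\times\nabla G)\bigr)\times(\nabla F\times\nabla G)\bigr|}{|\nabla F\times\nabla G|^3},$$ $$\tau=\frac{\det(\mathbf{r}'\ \mathbf{r}''\ \mathbf{r}''')}{|\mathbf{r}'\times\mathbf{r}''|^2}=\frac{\det(T^*\ T^{**}\ T^{***})}{|T^*\times T^{**}|^2},$$ where $\mathbf{r}$ is the cubic parametric curve used in the algorithm, $\mathbf{r}',\mathbf{r}'',\mathbf{r}'''$ are evaluated at $t=0$, all expressions in $F,G$ are evaluated at $P$, and $$T^*=\nabla F\times\nabla G,\qquad T^{**}=(\nabla F\times\nabla G)\cdot\nabla(\nabla F\times\nabla G),$$ $$T^{***}=(\nabla F\times\nabla G)\cdot\nabla\bigl(\nabla(\nabla F\times\nabla G)\bigr)\cdot(\nabla F\times\nabla G)+(\nabla F\times\nabla G)\cdot\nabla(\nabla F\times\nabla G)\cdot\nabla(\nabla F\times\nabla G).$$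
   Context: Notation: for the vector field $T=\nabla F\times\nabla G=(T_1,T_2,T_3)$ and coordinates $(x_1,x_2,x_3)=(x,y,z)$, $T\cdot\nabla T=\sum_j T_j\,\partial_{x_j}T$, $T\cdot\nabla(\nabla T)\cdot T=\sum_{j,k}T_jT_k\,\partial_{x_j}\partial_{x_k}T$, and $T\cdot\nabla T\cdot\nabla T=(T\cdot\nabla T)\cdot\nabla T=\sum_{j,k}T_k(\partial_{x_k}T_j)\,\partial_{x_j}T$. Cubic-contact algorithm at a regular point. Let $$\mathbf{r}(t)=P+t\,\mathbf{v}_1+\tfrac1{2!}t^2\mathbf{v}_2+\tfrac1{3!}t^3\mathbf{v}_3,\qquad \mathbf{v}_i=(a_i,b_i,c_i),\quad \mathbf{v}_1\neq0,$$ be a cubic parametric curve through $P$, so that $\mathbf{r}'(0)=\mathbf{v}_1$, $\mathbf{r}''(0)=\mathbf{v}_2$, $\mathbf{r}'''(0)=\mathbf{v}_3$, and expand $F(\mathbf{r}(t))=C_1t+C_2t^2+C_3t^3+\cdots$ and $G(\mathbf{r}(t))=D_1t+D_2t^2+D_3t^3+\cdots$. The tangent $\mathbf{v}_1$ of $\mathcal{C}$ at $P$ is determined by $C_1=D_1=0$. With this $\mathbf{v}_1$, the coefficients $\mathbf{v}_2$ are subjected to $C_2=D_2=0$, and the curvature of $\mathcal{C}$ at $P$ is taken to be the curvature $|\mathbf{r}'\times\mathbf{r}''|/|\mathbf{r}'|^3$ of $\mathbf{r}$ at $t=0$. With these $\mathbf{v}_1,\mathbf{v}_2$, the coefficients $\mathbf{v}_3$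 are subjected to $C_3=D_3=0$, and the torsion of $\mathcal{C}$ at $P$ is taken to be the torsion $\det(\mathbf{r}'\ \mathbf{r}''\ \mathbf{r}''')/|\mathbf{r}'\times\mathbf{r}''|^2$ of $\mathbf{r}$ at $t=0$. *)

(* Defs.v *)
From mathcomp Require Export all_boot all_order all_algebra.
From mathcomp Require Export reals mpoly.

Set Implicit Arguments.
Unset Strict Implicit.
Unset Printing Implicit Defensive.

Import GRing.Theory Num.Theory.
Local Open Scope ring_scope.

Definition crossv (A : comNzRingType) (u v : 'rV[A]_3) : 'rV[A]_3 :=
  let u1 := u 0 0 in let u2 := u 0 1 in let u3 := u 0 2%:R in
  let v1 := v 0 0 in let v2 := v 0 1 in let v3 := v 0 2%:R in
  row_mx (u2 * v3 - u3 * v2)%:M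
    (row_mx (u3 * v1 - u1 * v3)%:M (u1 * v2 - u2 * v1)%:M).

Definition det3 (A : comNzRingType) (u v w : 'rV[A]_3) : A :=
  \det (row_mx u^T (row_mx v^T w^T) : 'M[A]_3).

(* The library norm on matrices is the sup norm, hence this definition. *)
Definition enorm (R : realType) (u : 'rV[R]_3) : R :=
  Num.sqrt (\sum_j u 0 j ^+ 2).

Definition grad (R : realType) (F : {mpoly R[3]}) : 'rV[{mpoly R[3]}]_3 :=
  \row_j F^`M(j).

Definition evalv (R : realType) (P : 'rV[R]_3) (W : 'rV[{mpoly R[3]}]_3) :
    'rV[R]_3 :=
  map_mx (meval (P 0)) W.

(* U . nabla W *)
Definition convect (R : realType) (U W : 'rV[{mpoly R[3]}]_3) :
    'rV[{mpoly R[3]}]_3 :=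
  \sum_j U 0 j *: map_mx (mderiv j) W.

(* U . nabla (nabla W) . U *)
Definition convect2 (R : realType) (U W : 'rV[{mpoly R[3]}]_3) :
    'rV[{mpoly R[3]}]_3 :=
  \sum_j \sum_k (U 0 j * U 0 k) *: map_mx (fun f => (f^`M(k))^`M(j)) W.

Definition T1 (R : realType) (F G : {mpoly R[3]}) : 'rV[{mpoly R[3]}]_3 :=
  crossv (grad F) (grad G).

Definition T2 (R : realType) (F G : {mpoly R[3]}) : 'rV[{mpoly R[3]}]_3 :=
  convect (T1 F G) (T1 F G).

(* T . nabla T . nabla T is parsed as (T . nabla T) . nabla T. *)
Definition T3 (R : realType) (F G : {mpoly R[3]}) : 'rV[{mpoly R[3]}]_3 :=
  convect2 (T1 F G) (T1 F G) + convect (convect (T1 F G) (T1 F G)) (T1 F G).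

Definition regular_point (R : realType) (F G : {mpoly R[3]}) (P : 'rV[R]_3) :
    Prop :=
  [/\ F.@[P 0] = 0, G.@[P 0] = 0
    & evalv P (crossv (grad F) (grad G)) != 0].

(* A polynomial parametric curve is a vector of polynomials in t. *)
Definition cubic (R : realType) (P v1 v2 v3 : 'rV[R]_3) : 'rV[{poly R}]_3 :=
  \row_i ((P 0 i)%:P + v1 0 i *: 'X
          + ((2`!)%:R^-1 * v2 0 i) *: 'X^2 + ((3`!)%:R^-1 * v3 0 i) *: 'X^3).

(* The polynomial F(r(t)) in t; its coefficients are the C_i (D_i for G). *)
Definition along (R : realType) (F : {mpoly R[3]}) (r : 'rV[{poly R}]_3) :
    {poly R} :=
  mmap polyC (r 0) F.

Definition contact (R : realType) (F G : {mpoly R[3]}) (r : 'rV[{poly R}]_3)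
    (n : nat) : Prop :=
  forall i : nat, (0 < i <= n)%N ->
    (along F r)`_i = 0 /\ (along G r)`_i = 0.

Definition curve_deriv (R : realType) (k : nat) (r : 'rV[{poly R}]_3) (t : R) :
    'rV[R]_3 :=
  \row_i ((r 0 i)^`(k)).[t].

Definition curvature (R : realType) (r : 'rV[{poly R}]_3) (t : R) : R :=
  enorm (crossv (curve_deriv 1 r t) (curve_deriv 2 r t))
  / enorm (curve_deriv 1 r t) ^+ 3.

(* When r' x r'' = 0 the torsion is undefined; here it is then 0 / 0 = 0. *)
Definition torsion (R : realType) (r : 'rV[{poly R}]_3) (t : R) : R :=
  det3 (curve_deriv 1 r t) (curve_deriv 2 r t) (curve_deriv 3 r t)
  / enorm (crossv (curve_deriv 1 r t) (curve_deriv 2 r t)) ^+ 2.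

(* Main.v *)
Require Import Defs.
From mathcomp Require Import ring.

(* Write T, T2, T3 for T*, T**, T*** at P.  Since T = grad F x grad G,
   T . grad F vanishes identically; differentiating this identity once and
   twice along T gives
     grad F . T2 + D^2 F(T,T) = 0,
     grad F . T3 + 3 D^2 F(T,T2) + D^3 F(T,T,T) = 0,
   and likewise for G.  By the chain rule the contact equations have the same
   shape with v1, v2, v3 in place of T, T2, T3, and a vector orthogonal to
   both gradients is a multiple of T.  Hence contact of order 3 means
     v1 = l T,  v2 = l^2 T2 + m T,  v3 = l^3 T3 + 3 l m T2 + n T,
   and curvature and torsion do not depend on l, m, n. *)

Set Implicit Arguments.
Unset Strict Implicit.
Unset Printing Implicit Defensive.

Import GRing.Theory Num.Theory.
Local Open Scope ring_scope.

(** * Coordinates, cross product and determinant in dimension three *)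

Lemma sum3E (V : nmodType) (f : 'I_3 -> V) :
  \sum_i f i = f 0 + f 1 + f 2%:R.
Proof.
by rewrite !big_ord_recl big_ord0 addr0 addrA; congr (f _ + f _ + f _);
  apply/val_inj.
Qed.

Lemma ord3_ind (Q : 'I_3 -> Prop) : Q 0 -> Q 1 -> Q 2%:R -> forall i, Q i.
Proof.
move=> Q0 Q1 Q2 [[|[|[|//]]] h].
- by rewrite (_ : Ordinal h = 0) //; apply/val_inj.
- by rewrite (_ : Ordinal h = 1) //; apply/val_inj.
- by rewrite (_ : Ordinal h = 2%:R) //; apply/val_inj.
Qed.

Lemma row_mx3E (A : Type) m (a b c : 'cV[A]_m) (i : 'I_m) :
  let M : 'M[A]_(m, 3) := row_mx a (row_mx b c) in
  [/\ M i 0 = a i 0, M i 1 = b i 0 & M i 2%:R = c i 0].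
Proof.
rewrite /=.
have e0 : (0 : 'I_3) = lshift (1 + 1) (0 : 'I_1) by exact/val_inj.
have e1 : (1 : 'I_3) = rshift 1 (lshift 1 (0 : 'I_1)) by exact/val_inj.
have e2 : (2%:R : 'I_3) = rshift 1 (rshift 1 (0 : 'I_1)) by exact/val_inj.
split; [rewrite e0|rewrite e1|rewrite e2].
- exact: (row_mxEl a (row_mx b c) i 0).
- exact: etrans (row_mxEr a (row_mx b c) i _) (row_mxEl b c i 0).
- exact: etrans (row_mxEr a (row_mx b c) i _) (row_mxEr b c i 0).
Qed.

Lemma crossvE (A : comNzRingType) (u v : 'rV[A]_3) :
  [/\ crossv u v 0 0 = u 0 1 * v 0 2%:R - u 0 2%:R * v 0 1,
      crossv u v 0 1 = u 0 2%:R * v 0 0 - u 0 0 * v 0 2%:R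
    & crossv u v 0 2%:R = u 0 0 * v 0 1 - u 0 1 * v 0 0].
Proof.
rewrite /crossv; set a := _%:M; set b := _%:M; set c := _%:M.
by have [-> -> ->] := row_mx3E a b c 0; rewrite !mxE.
Qed.

Lemma det3E (A : comNzRingType) (u v w : 'rV[A]_3) :
  det3 u v w = u 0 0 * (v 0 1 * w 0 2%:R - v 0 2%:R * w 0 1)
             - u 0 1 * (v 0 0 * w 0 2%:R - v 0 2%:R * w 0 0)
             + u 0 2%:R * (v 0 0 * w 0 1 - v 0 1 * w 0 0).
Proof.
(* Indexing the entries by natural numbers lets the lifted ordinals of the Laplace expansion reduce
   by computation. *)
pose m (i j : nat) := nth 0 [:: u; v; w] j 0 (inord i).
have i0 : inord 0 = 0 :> 'I_3 by apply/val_inj; rewrite /= inordK.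
have i1 : inord 1 = 1 :> 'I_3 by apply/val_inj; rewrite /= inordK.
have i2 : inord 2 = 2%:R :> 'I_3 by apply/val_inj; rewrite /= inordK.
have -> : det3 u v w = \det (\matrix_(i < 3, j < 3) m i j).
  congr (\det _); apply/matrixP => i j; rewrite [RHS]mxE /m inord_val.
  have [e0 e1 e2] := row_mx3E u^T v^T w^T i.
  by elim/ord3_ind: j; rewrite ?e0 ?e1 ?e2 mxE.
rewrite (expand_det_row _ ord0) !big_ord_recl !big_ord0 /cofactor.
rewrite !(expand_det_row _ ord0) !big_ord_recl !big_ord0 /cofactor !det_mx11.
rewrite !mxE /m /= i0 i1 i2.
ring.
Qed.

(** * Chain rule and Taylor coefficients along the cubic *)

Lemma along_deriv (R : realType) (f : {mpoly R[3]}) (r : 'rV[{poly R}]_3) :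
  (along f r)^`() = \sum_j along f^`M(j) r * (r 0 j)^`().
Proof.
(* The chain rule is stable under sums and, by Leibniz, under products; it holds for constants and
   variables, hence for every polynomial. *)
pose Q f := (along f r)^`() = \sum_j along f^`M(j) r * (r 0 j)^`().
have QD p q : Q p -> Q q -> Q (p + q).
  rewrite /Q /along !rmorphD /= derivD => -> ->.
  by rewrite -big_split; apply: eq_bigr => j _; rewrite /= mderivD rmorphD mulrDl.
have QM p q : Q p -> Q q -> Q (p * q).
  rewrite /Q /along !rmorphM /= derivM => -> ->.
  rewrite mulr_suml mulr_sumr -big_split; apply: eq_bigr => j _ /=.
  rewrite mderivM rmorphD !rmorphM /=; ring.
have QC c : Q c%:MP.
  by rewrite /Q /along mmapC derivC big1 // => j _; rewrite mderivC rmorph0 mul0r.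
have QX i : Q 'X_i.
  rewrite /Q /along mmapX mmap1U (bigD1 i) //= big1 ?addr0 => [|j /negPf ij].
    rewrite mderivX mnm1E eqxx scale1r -[X in (X - _)%MM]add0m addmK.
    by rewrite mpolyX0 rmorph1 mul1r.
  by rewrite mderivX mnm1E eq_sym ij scale0r rmorph0 mul0r.
rewrite -/(Q f); elim/mpolyind: f => [|c m p _ _ Qp].
  by rewrite -mpolyC0; apply: QC.
apply: QD => //; rewrite -mul_mpolyC; apply/QM => //; rewrite mpolyXE_id.
apply: (big_ind Q) => [| |i _]; [exact: (QC 1)|exact: QM|].
by elim: (m i) => [|k IH]; [exact: (QC 1)|rewrite exprS; apply: QM].
Qed.

(* D^n f(P)(u1, ..., un) for us = [:: u1; ...; un]. *)
Fixpoint diffs (R : realType) (P : 'rV[R]_3) (f : {mpoly R[3]})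
    (us : seq 'rV[R]_3) : R :=
  if us is u :: vs then \sum_j u 0 j * diffs P f^`M(j) vs else f.@[P 0].

(** Comparing coefficients in the chain rule gives a recursion: each coefficient for [f] comes from
    lower coefficients for the first partial derivatives of [f]. *)
Lemma along_coefS (R : realType) (f : {mpoly R[3]}) (r : 'rV[{poly R}]_3) n :
  (along f r)`_n.+1 *+ n.+1 =
  \sum_j \sum_(i < n.+1)
    (along f^`M(j) r)`_i * ((r 0 j)`_(n - i).+1 *+ (n - i).+1).
Proof.
rewrite -coef_deriv along_deriv coef_sum; apply: eq_bigr => j _.
by rewrite coefM; apply: eq_bigr => i _; rewrite coef_deriv.
Qed.

Lemma along_coef0 (R : realType) (f : {mpoly R[3]}) (P v1 v2 v3 : 'rV[R]_3) :
  (along f (cubic P v1 v2 v3))`_0 = f.@[P 0].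
Proof.
rewrite -horner_coef0 /along /meval /mmap horner_sum; apply: eq_bigr => m _.
rewrite hornerM hornerC /mmap1 horner_prod; congr (_ * _).
apply: eq_bigr => i _.
by rewrite horner_exp mxE !hornerE /= !mulr0 !addr0.
Qed.

Lemma cubic_coef (R : realType) (P v1 v2 v3 : 'rV[R]_3) j :
  let p := cubic P v1 v2 v3 0 j in
  [/\ p`_1 = v1 0 j, p`_2 *+ 2 = v2 0 j & p`_3 *+ 3 *+ 2 = v3 0 j].
Proof.
have [f2 f3] : 2`! = 2%N /\ 3`! = 6%N by [].
rewrite /= mxE f2 f3 !(coefD, coefZ, coefC, coefX, coefXn) /=.
by split; rewrite !(mulr0, mulr1, add0r, addr0) //; field.
Qed.

Section Taylor.
Variables (R : realType) (P v1 v2 v3 : 'rV[R]_3).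
Implicit Type f : {mpoly R[3]}.
Let r := cubic P v1 v2 v3.
Let c f := along f r.

Lemma along_coef1 f : (c f)`_1 = diffs P f [:: v1].
Proof.
rewrite -[LHS]mulr1n along_coefS; apply: eq_bigr => j _.
have [r1 _ _] := cubic_coef P v1 v2 v3 j.
by rewrite [LHS]big_ord_recl [in LHS]big_ord0 addr0 /= along_coef0 r1 mulrC.
Qed.

Lemma along_coef2 f :
  (c f)`_2 *+ 2 = diffs P f [:: v2] + diffs P f [:: v1; v1].
Proof.
rewrite along_coefS -big_split; apply: eq_bigr => j _.
have [r1 r2 _] := cubic_coef P v1 v2 v3 j.
rewrite ![in LHS]big_ord_recl [in LHS]big_ord0 addr0 /=.
rewrite along_coef0 r1 r2 along_coef1 /=.
have bE n : bump 0 n = n.+1 by [].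
rewrite !bE !subSS subn0.
ring.
Qed.

(** The mixed second-order terms stay apart, two with [v2] outermost and one with [v1] outermost, as
    the recursion produces them; [tangent_diffs3] has the same shape. *)
Lemma along_coef3 f :
  (c f)`_3 *+ 3 *+ 2 = diffs P f [:: v3] + diffs P f [:: v2; v1] *+ 2
    + diffs P f [:: v1; v2] + diffs P f [:: v1; v1; v1].
Proof.
rewrite along_coefS -!sumrMnl -!big_split; apply: eq_bigr => j _ /=.
have [r1 r2 r3] := cubic_coef P v1 v2 v3 j.
rewrite ![in LHS]big_ord_recl [in LHS]big_ord0 addr0 /= along_coef0.
rewrite !(mulrnDl, addrA) -mulrnAr r3 r2 along_coef1 /=.
have bE n : bump 0 n = n.+1 by [].
rewrite !bE !subSS !subn0.
rewrite [(r 0 j)`_1]r1 mulr1n.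
rewrite -/(c _); set c2 := (c _)`_2.
have : c2 *+ 2 = _ := along_coef2 f^`M(j); rewrite /=.
set S2 := \sum_j0 _; set S11 := \sum_j0 _; set S1 := \sum_j0 _ => e.
(* Regrouping makes twice the second coefficient of the partial derivative appear, to which
   [along_coef2] applies. *)
transitivity ((f^`M(j)).@[P 0] * v3 0 j + S1 * v2 0 j *+ 2 + c2 *+ 2 * v1 0 j).
  by ring.
by rewrite e; ring.
Qed.

End Taylor.

(** * Vectors orthogonal to two independent vectors *)

Lemma crossv_orth (R : realFieldType) (a b u : 'rV[R]_3) :
  crossv a b != 0 -> \sum_j u 0 j * a 0 j = 0 -> \sum_j u 0 j * b 0 j = 0 ->
  exists l, u = l *: crossv a b.
Proof.
set n := crossv a b => n0 ua ub.
have nn : \sum_j n 0 j ^+ 2 != 0.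
  apply: contra n0 => /eqP s0; apply/eqP/rowP => j; rewrite [RHS]mxE.
  apply/eqP; rewrite -sqrf_eq0; apply/eqP.
  by apply: (psumr_eq0P _ s0) => // k _; apply: sqr_ge0.
(* The coefficient is that of the orthogonal projection of [u] onto the line of [n]. *)
exists ((\sum_j u 0 j * n 0 j) / \sum_j n 0 j ^+ 2).
apply/rowP => i; rewrite mxE mulrAC; apply/(canRL (mulfK nn)).
(* n x (u x n) = |n|^2 u - (u . n) n with u x n = (u . b) a - (u . a) b *)
suff : u 0 i * \sum_j n 0 j ^+ 2 - (\sum_j u 0 j * n 0 j) * n 0 i =
    (\sum_j u 0 j * b 0 j) * crossv n a 0 i
  - (\sum_j u 0 j * a 0 j) * crossv n b 0 i.
  by rewrite ua ub !mul0r subr0 => /eqP; rewrite subr_eq0 => /eqP.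
have [a0 a1 a2] := crossvE n a; have [b0 b1 b2] := crossvE n b.
have [e0 e1 e2] := crossvE a b; rewrite -/n in e0 e1 e2.
by elim/ord3_ind: i; rewrite !sum3E ?(a0, a1, a2) ?(b0, b1, b2) e0 e1 e2; ring.
Qed.

(** * Differentiating the identity T . grad f = 0 *)

Section Tangent.
Variables (R : realType) (P : 'rV[R]_3) (f : {mpoly R[3]}).
Variable T : 'rV[{mpoly R[3]}]_3.
Hypothesis Tf : \sum_j T 0 j * f^`M(j) = 0.

Lemma evalv_convect U W i : evalv P (convect U W) 0 i =
  \sum_j evalv P U 0 j * ((W 0 i)^`M(j)).@[P 0].
Proof.
rewrite mxE summxE raddf_sum; apply: eq_bigr => j _.
by rewrite /= !mxE mevalM.
Qed.

Lemma evalv_convect2 U W i : evalv P (convect2 U W) 0 i =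
  \sum_j \sum_k evalv P U 0 j * evalv P U 0 k
    * ((W 0 i)^`M(k)^`M(j)).@[P 0].
Proof.
rewrite mxE summxE raddf_sum; apply: eq_bigr => j _.
rewrite /= summxE raddf_sum; apply: eq_bigr => k _.
by rewrite /= !mxE !mevalM.
Qed.

Let t i := evalv P T 0 i.
Let tE i : (T 0 i).@[P 0] = t i. Proof. by rewrite /t mxE. Qed.
Let dt i j := ((T 0 i)^`M(j)).@[P 0].
Let d1 j := (f^`M(j)).@[P 0].
Let d2 i j := (f^`M(i)^`M(j)).@[P 0].
Let d3 i j k := (f^`M(i)^`M(j)^`M(k)).@[P 0].

Let eq1 k : \sum_j (dt j k * d1 j + t j * d2 j k) = 0.
Proof.
transitivity (\sum_j T 0 j * f^`M(j))^`M(k).@[P 0].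
  rewrite (raddf_sum (mderiv k)) raddf_sum; apply: eq_bigr => j _.
  by rewrite /= mderivM mevalD !mevalM tE.
by rewrite Tf mderiv0 meval0.
Qed.

Let eq2 k l : \sum_j (((T 0 j)^`M(k)^`M(l)).@[P 0] * d1 j + dt j k * d2 j l
   + dt j l * d2 j k + t j * d3 j k l) = 0.
Proof.
transitivity (\sum_j T 0 j * f^`M(j))^`M(k)^`M(l).@[P 0].
  rewrite (raddf_sum (mderiv k)) (raddf_sum (mderiv l)) raddf_sum.
  apply: eq_bigr => j _.
  by rewrite /= mderivM mderivD !mderivM !mevalD !mevalM tE !addrA.
by rewrite Tf !mderiv0 meval0.
Qed.

Let dtT i : evalv P (convect T T) 0 i = \sum_j t j * dt i j.
Proof. exact: evalv_convect. Qed.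

(** Contract [eq1], the first derivatives of T . grad f, with T: the terms that differentiate T
    assemble into T . grad T, the others into D^2 f(T,T). *)
Lemma tangent_diffs2 :
  diffs P f [:: evalv P (convect T T)] + diffs P f [:: evalv P T; evalv P T] = 0.
Proof.
transitivity (\sum_k t k * \sum_j (dt j k * d1 j + t j * d2 j k)); last first.
  by rewrite big1 // => k _; rewrite eq1 mulr0.
under [RHS]eq_bigr do rewrite mulr_sumr.
rewrite [RHS]exchange_big -big_split; apply: eq_bigr => j _ /=.
rewrite dtT mulr_suml mulr_sumr -big_split; apply: eq_bigr => k _ /=.
rewrite -!/(t _) -!/(d1 _) -!/(d2 _ _) mulrDr.
congr (_ + _); [by rewrite mulrA|exact: mulrCA].
Qed.

(** Differentiating T . grad f twice along T gives [eq2] contracted twice with T plus [eq1]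
    contracted with T . grad T. The former yields the [convect2] summand of T***, the latter the
    summand (T . grad T) . grad T. *)
Lemma tangent_diffs3 :
  diffs P f [:: evalv P (convect2 T T) + evalv P (convect (convect T T) T)]
  + diffs P f [:: evalv P (convect T T); evalv P T] *+ 2
  + diffs P f [:: evalv P T; evalv P (convect T T)]
  + diffs P f [:: evalv P T; evalv P T; evalv P T] = 0.
Proof.
pose s k := evalv P (convect T T) 0 k.
transitivity (\sum_k s k * \sum_j (dt j k * d1 j + t j * d2 j k)
  + \sum_k \sum_l t k * t l * \sum_j (((T 0 j)^`M(l)^`M(k)).@[P 0] * d1 j
    + dt j l * d2 j k + dt j k * d2 j l + t j * d3 j l k)); last first.
  rewrite !big1 ?addr0 // => k _; last by rewrite eq1 mulr0.
  by rewrite big1 // => l _; rewrite eq2 mulr0.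
under [in RHS]eq_bigr do rewrite mulr_sumr.
under [X in _ = _ + X]eq_bigr => k _.
  under eq_bigr do rewrite mulr_sumr.
  rewrite exchange_big; over.
rewrite [X in _ = X + _]exchange_big [X in _ = _ + X]exchange_big /=.
rewrite -sumrMnl -!big_split.
apply: eq_bigr => j _ /=.
rewrite mxE evalv_convect2 (evalv_convect (convect T T)) (dtT j).
rewrite !sum3E -!/(s _) -!/(t _) -!/(d1 _) -!/(d2 _ _) -!/(d3 _ _ _) -!/(dt _ _).
(* The identity already holds for each outer index [j]; the derivatives and indices become opaque
   atoms for [ring]. *)
move: (d1 j) (d2 j) (d3 j) (dt j) => a1 a2 a3 a4.
move: (0 : 'I_3) (1 : 'I_3) (2%:R : 'I_3) => i0 i1 i2.
ring.
Qed.
End Tangent.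

(** * Derivatives of the cubic and effect of triangular changes of vectors *)

Lemma curve_deriv_cubic (R : realType) (P v1 v2 v3 : 'rV[R]_3) :
  let r := cubic P v1 v2 v3 in
  [/\ curve_deriv 1 r 0 = v1, curve_deriv 2 r 0 = v2 & curve_deriv 3 r 0 = v3].
Proof.
split; apply/rowP => j; rewrite mxE horner_coef0 coef_derivn addn0 ffactnn;
  have [r1 r2 r3] := cubic_coef P v1 v2 v3 j.
- by rewrite -r1.
- by rewrite -r2.
- by rewrite -r3 -mulrnA.
Qed.

Lemma enormZ (R : realType) l (u : 'rV[R]_3) : enorm (l *: u) = `|l| * enorm u.
Proof.
rewrite /enorm -sqrtr_sqr -sqrtrM ?sqr_ge0 // mulr_sumr; congr Num.sqrt.
by apply: eq_bigr => j _; rewrite mxE exprMn.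
Qed.

Lemma evalv_crossv (R : realType) (P : 'rV[R]_3) U W :
  evalv P (crossv U W) = crossv (evalv P U) (evalv P W).
Proof.
have [e0 e1 e2] := crossvE U W.
have [d0 d1 d2] := crossvE (evalv P U) (evalv P W).
apply/rowP; elim/ord3_ind; rewrite mxE;
  by rewrite ?(e0, e1, e2) ?(d0, d1, d2) mevalB !mevalM !mxE.
Qed.

Lemma crossvC (A : comNzRingType) (u v : 'rV[A]_3) : crossv u v = - crossv v u.
Proof.
have [e0 e1 e2] := crossvE u v; have [d0 d1 d2] := crossvE v u.
by apply/rowP; elim/ord3_ind; rewrite [RHS]mxE ?(e0, e1, e2) ?(d0, d1, d2); ring.
Qed.

Lemma crossv_osculating (A : comNzRingType) (l k m : A) (u v : 'rV[A]_3) :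
  crossv (l *: u) (k *: v + m *: u) = (l * k) *: crossv u v.
Proof.
have [e0 e1 e2] := crossvE (l *: u) (k *: v + m *: u).
have [d0 d1 d2] := crossvE u v.
by apply/rowP; elim/ord3_ind; rewrite [RHS]mxE ?e0 ?e1 ?e2 ?d0 ?d1 ?d2 !mxE; ring.
Qed.

(** The change of columns is triangular with diagonal [l], [k], [h]. *)
Lemma det3_osculating (A : comNzRingType) (l k h m n p : A) (u v w : 'rV[A]_3) :
  det3 (l *: u) (k *: v + m *: u) (h *: w + p *: v + n *: u)
  = l * k * h * det3 u v w.
Proof. by rewrite !det3E !mxE; ring. Qed.

(** * Multilinearity and symmetry of the differentials *)

Section Diffs.
Variables (R : realType) (P : 'rV[R]_3).
Implicit Types (f : {mpoly R[3]}) (u v w : 'rV[R]_3).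

Lemma diffsD f u v us :
  diffs P f (u + v :: us) = diffs P f (u :: us) + diffs P f (v :: us).
Proof. by rewrite /= -big_split; apply: eq_bigr => j _; rewrite mxE mulrDl. Qed.

Lemma diffsZ f l u us : diffs P f (l *: u :: us) = l * diffs P f (u :: us).
Proof. by rewrite /= mulr_sumr; apply: eq_bigr => j _; rewrite mxE mulrA. Qed.

Lemma diffsC f u v us : diffs P f [:: u, v & us] = diffs P f [:: v, u & us].
Proof.
rewrite /=; under eq_bigr do rewrite mulr_sumr.
rewrite exchange_big; apply: eq_bigr => j _ /=; rewrite mulr_sumr.
by apply: eq_bigr => i _; rewrite mderiv_comm mulrCA.
Qed.

Lemma diffs_scale f l us :
  diffs P f [seq l *: u | u <- us] = l ^+ size us * diffs P f us.
Proof.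
elim: us f => [|u us IH] f; first by rewrite mul1r.
rewrite map_cons diffsZ exprS -mulrA; congr (_ * _).
by rewrite /= mulr_sumr; apply: eq_bigr => j _; rewrite IH mulrCA.
Qed.

End Diffs.

(** * Solving the contact equations order by order *)

Section Osculation.
Variables (R : realType) (F G : {mpoly R[3]}) (P : 'rV[R]_3).
Hypothesis hP : regular_point F G P.
Let t1 := evalv P (T1 F G).
Let t2 := evalv P (T2 F G).
Let t3 := evalv P (T3 F G).

Lemma T1_grad :
  \sum_j T1 F G 0 j * F^`M(j) = 0 /\ \sum_j T1 F G 0 j * G^`M(j) = 0.
Proof.
rewrite /T1 !sum3E; have [-> -> ->] := crossvE (grad F) (grad G).
by rewrite !mxE; split; ring.
Qed.

(** At a regular point the common kernel of the two differentials is the tangent line; every contact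
    order reduces to this linear system. *)
Lemma orth_gradP u :
  diffs P F [:: u] = 0 /\ diffs P G [:: u] = 0 <-> exists n, u = n *: t1.
Proof.
have [_ _ t0] := hP; split => [[uF uG]|[n ->]].
  rewrite /t1 evalv_crossv; apply: crossv_orth; first by rewrite -evalv_crossv.
    by rewrite -[RHS]uF; apply: eq_bigr => j _; rewrite !mxE.
  by rewrite -[RHS]uG; apply: eq_bigr => j _; rewrite !mxE.
have [TF TG] := T1_grad.
have e f : \sum_j T1 F G 0 j * f^`M(j) = 0 -> diffs P f [:: t1] = 0.
  move=> /(congr1 (meval (P 0))); rewrite meval0 raddf_sum => <-.
  by apply: eq_bigr => j _; rewrite /= mevalM mxE.
by rewrite !diffsZ !e ?mulr0.
Qed.

Lemma contact1P v1 v2 v3 :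
  contact F G (cubic P v1 v2 v3) 1 <-> exists l, v1 = l *: t1.
Proof.
rewrite -orth_gradP -!(along_coef1 P v1 v2 v3); split => [|e [|[|i]] //].
by apply.
Qed.

Section TangentialForms.
Variable f : {mpoly R[3]}.
Hypothesis Tf : \sum_j T1 F G 0 j * f^`M(j) = 0.

(** Subtracting [l ^+ 2] times [tangent_diffs2] from the Taylor formula removes D^2 f(T,T) and
    leaves a linear equation; the factor 2 is harmless in characteristic zero. *)
Lemma along_coef2_eq0 l v2 v3 :
  (along f (cubic P (l *: t1) v2 v3))`_2 = 0 <->
  diffs P f [:: v2 - l ^+ 2 *: t2] = 0.
Proof.
have e : (along f (cubic P (l *: t1) v2 v3))`_2 *+ 2
    = diffs P f [:: v2 - l ^+ 2 *: t2].
  have /eqP := tangent_diffs2 P Tf; rewrite addrC addr_eq0 -/t1 -/t2 => /eqP e.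
  rewrite along_coef2 [X in _ + X](diffs_scale P f l [:: t1; t1]) e.
  by rewrite diffsD -scaleNr diffsZ mulrN mulNr.
by rewrite -e; split => [->|/eqP]; rewrite ?mul0rn // mulrn_eq0 => /eqP.
Qed.

Lemma along_coef3_eq0 l m v3 :
  (along f (cubic P (l *: t1) (l ^+ 2 *: t2 + m *: t1) v3))`_3 = 0 <->
  diffs P f [:: v3 - (l ^+ 3 *: t3 + (3 * l * m) *: t2)] = 0.
Proof.
have e : (along f (cubic P (l *: t1) (l ^+ 2 *: t2 + m *: t1) v3))`_3 *+ 3 *+ 2
    = diffs P f [:: v3 - (l ^+ 3 *: t3 + (3 * l * m) *: t2)].
  have e2 := tangent_diffs2 P Tf; have e3 := tangent_diffs3 P Tf.
  rewrite -[convect (T1 F G) (T1 F G)]/(T2 F G) -/t1 -/t2 in e2 e3.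
  have e4 : t3 = evalv P (convect2 (T1 F G) (T1 F G))
               + evalv P (convect (T2 F G) (T1 F G)).
    by apply/rowP => i; rewrite !mxE mevalD.
  rewrite -e4 [diffs P f [:: t1; t2]]diffsC in e3.
  rewrite along_coef3 [X in _ + X = _](diffs_scale P f l [:: t1; t1; t1]).
  rewrite [diffs P f [:: l *: t1; _]]diffsC opprD -!scaleNr !diffsD !diffsZ.
  rewrite ![diffs P f [:: _; l *: t1]]diffsC !diffsZ.
  rewrite [diffs P f [:: t1; t2]]diffsC /size.
  apply/eqP; rewrite -subr_eq0; apply/eqP.
  (* The difference of the two sides is [l ^+ 3] times the third-order identity plus [3 * l * m]
     times the second-order one. *)
  transitivity (l ^+ 3 * 0 + 3 * l * m * 0 : R); last by rewrite !mulr0 addr0.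
  rewrite -{1}e3 -e2; ring.
by rewrite -e; split => [->|/eqP]; rewrite ?mul0rn // !mulrn_eq0 => /eqP.
Qed.

End TangentialForms.

Lemma contactS r n : contact F G r n.+1 <->
  contact F G r n /\ (along F r)`_n.+1 = 0 /\ (along G r)`_n.+1 = 0.
Proof.
split => [c|[c e] i /andP[i0]].
  by split=> [i /andP[i0 ile]|]; apply: c; rewrite ?i0 ?leqnn // leqW.
by rewrite leq_eqVlt => /orP[/eqP -> //|ilt]; apply: c; rewrite i0.
Qed.

Lemma contact2P v1 v2 v3 : contact F G (cubic P v1 v2 v3) 2 <->
  exists l m, v1 = l *: t1 /\ v2 = l ^+ 2 *: t2 + m *: t1.
Proof.
have [TF TG] := T1_grad; rewrite contactS contact1P; split.
  move=> [[l ->]] [/(along_coef2_eq0 TF) eF /(along_coef2_eq0 TG) eG].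
  have [m /eqP] := (orth_gradP _).1 (conj eF eG).
  by rewrite subr_eq addrC => /eqP ->; exists l, m.
move=> [l [m [-> ->]]]; split; first by exists l.
rewrite along_coef2_eq0 // along_coef2_eq0 // orth_gradP.
by exists m; rewrite addrC addKr.
Qed.

(** These are the derivatives at P of a reparametrised integral curve of T, where [l], [m], [n] are
    the first three derivatives of the change of parameter; hence the factor 3. *)
Lemma contact3P v1 v2 v3 : contact F G (cubic P v1 v2 v3) 3 <->
  exists l m n, [/\ v1 = l *: t1, v2 = l ^+ 2 *: t2 + m *: t1
    & v3 = l ^+ 3 *: t3 + (3 * l * m) *: t2 + n *: t1].
Proof.
have [TF TG] := T1_grad; rewrite contactS contact2P; split.
  move=> [[l [m [-> ->]]]] [/(along_coef3_eq0 TF) eF /(along_coef3_eq0 TG) eG].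
  have [n /eqP] := (orth_gradP _).1 (conj eF eG).
  by rewrite subr_eq addrC => /eqP ->; exists l, m, n.
move=> [l [m [n [-> -> ->]]]]; split; first by exists l, m.
rewrite along_coef3_eq0 // along_coef3_eq0 // orth_gradP.
by exists n; rewrite [in LHS]addrC addKr.
Qed.

End Osculation.

(** * Solvability at each stage, then curvature and torsion *)

Theorem theorem3 (R : realType) (F G : {mpoly R[3]}) (P : 'rV[R]_3)
  (hP : regular_point F G P) :
  (exists v1 : 'rV[R]_3, v1 != 0 /\
     forall v2 v3 : 'rV[R]_3, contact F G (cubic P v1 v2 v3) 1)
  /\
  (forall v1 v2 v3 : 'rV[R]_3, v1 != 0 ->
     contact F G (cubic P v1 v2 v3) 1 ->
     exists w2 : 'rV[R]_3, forall w3 : 'rV[R]_3,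
       contact F G (cubic P v1 w2 w3) 2)
  /\
  (forall v1 v2 v3 : 'rV[R]_3, v1 != 0 ->
     contact F G (cubic P v1 v2 v3) 2 ->
     exists w3 : 'rV[R]_3, contact F G (cubic P v1 v2 w3) 3)
  /\
  (forall v1 v2 v3 : 'rV[R]_3, v1 != 0 ->
     contact F G (cubic P v1 v2 v3) 2 ->
     curvature (cubic P v1 v2 v3) 0 =
       enorm (evalv P (crossv (convect (crossv (grad F) (grad G))
                                       (crossv (grad F) (grad G)))
                              (crossv (grad F) (grad G))))
       / enorm (evalv P (crossv (grad F) (grad G))) ^+ 3)
  /\
  (forall v1 v2 v3 : 'rV[R]_3, v1 != 0 ->
     contact F G (cubic P v1 v2 v3) 3 ->
     torsion (cubic P v1 v2 v3) 0 =
       det3 (evalv P (T1 F G)) (evalv P (T2 F G)) (evalv P (T3 F G))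
       / enorm (crossv (evalv P (T1 F G)) (evalv P (T2 F G))) ^+ 2).
Proof.
split.
  exists (evalv P (T1 F G)); split; first by have [] := hP.
  by move=> v2 v3; apply/(contact1P hP); exists 1; rewrite scale1r.
split.
  move=> v1 v2 v3 _ /(contact1P hP)[l ->].
  exists (l ^+ 2 *: evalv P (T2 F G)) => w3; apply/(contact2P hP).
  by exists l, 0; rewrite scale0r addr0.
split.
  move=> v1 v2 v3 _ /(contact2P hP)[l [m [-> ->]]].
  exists (l ^+ 3 *: evalv P (T3 F G) + (3 * l * m) *: evalv P (T2 F G)).
  by apply/(contact3P hP); exists l, m, 0; rewrite scale0r addr0.
split=> v1 v2 v3 v1_neq0.
  move=> /(contact2P hP)[l [m [e1 e2]]].
  (* The numerator scales by [l] times [l ^+ 2], the denominator by the cube of the absolute value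
     of [l]. *)
  have l0 : l ^+ 3 != 0.
    apply: contraNneq v1_neq0 => /eqP; rewrite e1 expf_eq0 => /eqP ->.
    by rewrite scale0r.
  have [d1 d2 _] := curve_deriv_cubic P v1 v2 v3.
  rewrite /curvature d1 d2 e1 e2 crossv_osculating -exprS !enormZ.
  (* The stated formula has T** x T*, the opposite order; the norm absorbs the sign. *)
  rewrite [X in _ = enorm X / _]evalv_crossv [X in _ = enorm X / _]crossvC.
  rewrite -scaleN1r enormZ normrN1 mul1r.
  rewrite -[evalv P (crossv _ _)]/(evalv P (T1 F G)).
  by rewrite exprMn normrX -mulf_div divff ?mul1r // -normrX normr_eq0.
move=> /(contact3P hP)[l [m [n [e1 e2 e3]]]].
(* The determinant scales by [l * l ^+ 2 * l ^+ 3] and the squared norm by the square of [l ^+ 3].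
   Only this common factor is cancelled, so the case T* x T** = 0, where both quotients are 0 by
   convention, is covered too. *)
have l0 : l ^+ 6 != 0.
  apply: contraNneq v1_neq0 => /eqP; rewrite e1 expf_eq0 => /eqP ->.
  by rewrite scale0r.
have [d1 d2 d3] := curve_deriv_cubic P v1 v2 v3.
rewrite /torsion d1 d2 d3 e1 e2 e3 crossv_osculating -exprS !enormZ.
rewrite exprMn real_normK ?num_real // -exprM.
by rewrite det3_osculating -exprS -exprD -mulf_div divff ?mul1r.
Qed.
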